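(* For any $0 \leq \sigma < \frac{1}{4}(9 - \sqrt{17})$ there is a set $P \subset \mathbb{R}$ of full Lebesgue measure such that for every $\alpha \in P$ the sequence $\{\alpha n^2\}_n$ exhibits $\sigma$-pair correlation, i.e. for every interval $[a,b]$, \[ \mathrm{R}_2^\sigma([a,b], \{\alpha n^2\}_n, N) \to b-a \quad \text{as } N \to \infty . \]
   Context: For a real sequence $\{\theta_n\}_n$, $0 \leq \sigma < 2$, an interval $[a,b]$ and $N \in \mathbb{N}$, define \[ \mathrm{R}_2^\sigma([a,b], \{\theta_n\}_n, N) = \frac{1}{N^{2-\sigma}} \#\Big\{ 1 \leq j \neq k \leq N \;\Big|\; \theta_j - \theta_k \in \Big[\frac{a}{N^\sigma}, \frac{b}{N^\sigma}\Big] + \mathbb{Z} \Big\}. \] The sequence exhibits $\sigma$-pair correlation if $\mathrm{R}_2^\sigma([a,b],\{\theta_n\}_n,N) \to b-a$ as $N\to\infty$ for all intervals $[a,b]$.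
   Formalization: For σ = 0 only, the intervals [a,b] are restricted to length b−a ≤ 1, since for b−a > 1 the set [a,b]+ℤ is all of ℝ and R₂ tends to 1 rather than b−a for every sequence. *)

(* Defs.v *)
From HB Require Import structures.
From mathcomp Require Import all_boot all_order all_algebra.
From mathcomp Require Import all_classical all_reals all_analysis.

Set Implicit Arguments.
Unset Strict Implicit.
Unset Printing Implicit Defensive.

Import Order.TTheory GRing.Theory Num.Theory.
Import numFieldNormedType.Exports.

Local Open Scope classical_set_scope.
Local Open Scope ring_scope.

Definition itv_add_int (R : realType) (a b : R) : set R :=
  [set x + m%:~R | x in `[a, b] & m in [set: int]].

(* Sequences are indexed from 1: [theta 0] is never used, and an ordinal [j]
   below [N] stands for the index [j.+1] in {1, ..., N}. *)
Definition pair_count (R : realType) (sigma a b : R) (theta : nat -> R)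
    (N : nat) : nat :=
  #|[pred jk : 'I_N * 'I_N | (jk.1 != jk.2) &&
      (theta jk.1.+1 - theta jk.2.+1
         \in itv_add_int (a / N%:R `^ sigma) (b / N%:R `^ sigma))]|.

Definition R2 (R : realType) (sigma a b : R) (theta : nat -> R) (N : nat) : R :=
  (N%:R `^ (2 - sigma))^-1 * (pair_count sigma a b theta N)%:R.

(* When [sigma = 0] the window [a, b] does not shrink, so if [b - a >= 1] then
   [a, b] + Z is all of R and R2 = (N^2 - N) / N^2 tends to 1 for any sequence.
   Hence intervals longer than 1 are excluded, for [sigma = 0] only. *)
Definition pair_correlation (R : realType) (sigma : R) (theta : nat -> R) :
    Prop :=
  forall a b : R, a <= b -> (sigma = 0 -> b - a <= 1) ->
    R2 sigma a b theta N @[N --> \oo] --> b - a.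

(* Main.v *)
Require Import Defs.
From HB Require Import structures.
From mathcomp Require Import all_boot all_order all_algebra.
From mathcomp Require Import all_classical all_reals all_analysis.
From mathcomp Require Import measurable_realfun zify lra ring.

Set Implicit Arguments.
Unset Strict Implicit.
Unset Printing Implicit Defensive.

Import Order.TTheory GRing.Theory Num.Theory.
Import numFieldNormedType.Exports.

(* The pair count at scale h = (b - a) / N^sigma is the number of pairs p with
   D_p alpha in [A, B] + Z, where D_p = j^2 - k^2. Its second moment in alpha is
   computed by averaging over the translates alpha + i / M with M divisible by
   all the D_p: translating by multiples of 1 / D_p fixes the condition for p
   and spreads the one for q evenly, so the two events correlate by at most
   h gcd(D_p, D_q) / max(|D_p|, |D_q|). By the divisor bound these correlations
   sum to h N^(2 + o(1)), so the normalised variance is N^(sigma - 2 + o(1)).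
   Chebyshev and Borel-Cantelli give convergence for almost every alpha along
   N = k^8; since ((k + 1) / k)^8 -> 1 and pair counts are monotone in N and in
   the interval, squeezing between rational intervals gives all N and all
   [a, b]. With the divisor bound in the form tau(m) = O(m^(1/8)), this works
   for sigma <= 5 / 4, and (9 - sqrt 17) / 4 < 5 / 4. *)

(** * Divisor bound *)

(** A divisor [d] of [m * n] is the product of [gcdn d m], which divides [m], and [d %/ gcdn d m],
    which divides [n]. *)
Lemma size_divisorsM m n : 0 < m -> 0 < n ->
  size (divisors (m * n)) <= size (divisors m) * size (divisors n).
Proof.
move=> m0 n0.
rewrite -(size_allpairs (fun x y => x * y)) uniq_leq_size ?divisors_uniq//.
move=> d; rewrite -dvdn_divisors ?muln_gt0 ?m0// => dmn.
have g0 : 0 < gcdn d m by rewrite gcdn_gt0 m0 orbT.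
apply/allpairsP; exists (gcdn d m, d %/ gcdn d m) => /=.
split; last by rewrite mulnC divnK ?dvdn_gcdl.
  by rewrite -dvdn_divisors// dvdn_gcdr.
rewrite -dvdn_divisors//.
have cop : coprime (d %/ gcdn d m) (m %/ gcdn d m).
  rewrite /coprime -(eqn_pmul2r g0) mul1n muln_gcdl.
  by rewrite !divnK ?dvdn_gcdl ?dvdn_gcdr.
rewrite -(Gauss_dvdr _ cop) -(dvdn_pmul2r g0) mulnAC divnK ?dvdn_gcdl//.
by rewrite divnK ?dvdn_gcdr.
Qed.

Lemma size_divisorsX p a : prime p -> size (divisors (p ^ a)) <= a.+1.
Proof.
move=> pp.
have <- : size [seq p ^ i | i <- iota 0 a.+1] = a.+1 by rewrite size_map size_iota.
rewrite uniq_leq_size ?divisors_uniq// => d.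
rewrite -dvdn_divisors ?expn_gt0 ?prime_gt0// => /(dvdn_pfactor _ _ pp)[i ia ->].
by apply: map_f; rewrite mem_iota.
Qed.

(** With e = a %/ k, one has a + 1 <= k (e + 1) <= k 2^e; raise this to the power [k]. *)
Lemma expn_le_exp2 k a : 0 < k -> a.+1 ^ k <= k ^ k * 2 ^ a.
Proof.
move=> k0; apply: (@leq_trans ((k * 2 ^ (a %/ k)) ^ k)).
  rewrite leq_exp2r//; apply: (@leq_trans (k * (a %/ k).+1)).
    by rewrite mulnC {1}(divn_eq a k) mulSn addnC ltn_add2r ltn_mod.
  by rewrite leq_mul2l ltn_expl// orbT.
by rewrite expnMn leq_mul2l -expnM leq_exp2l// leq_divM orbT.
Qed.

(** Removing one prime factor p at most halves the number of divisors, and the lost factor 2^k is at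
    most p. *)
Lemma rough_size_divisors k m : 0 < m ->
  (forall p, prime p -> p %| m -> 2 ^ k <= p) -> size (divisors m) ^ k <= m.
Proof.
elim/ltn_ind: m => m IH m0 rough.
have [m1|m1] := leqP m 1.
  have -> : m = 1 by lia.
  by rewrite /= exp1n.
have pp := pdiv_prime m1; have pm := pdiv_dvd m.
have p0 := prime_gt0 pp; have p1 := prime_gt1 pp.
set p := pdiv m in pp pm p0 p1.
have mE : m = m %/ p * p by rewrite divnK.
have q0 : 0 < m %/ p by rewrite divn_gt0// dvdn_leq.
apply: (@leq_trans ((size (divisors (m %/ p)) * 2) ^ k)).
  case: k {IH rough} => // k; rewrite leq_exp2r// {1}mE.
  apply: leq_trans (size_divisorsM q0 p0) _.
  by rewrite leq_mul2l -{2}(expn1 p) (size_divisorsX 1)// orbT.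
rewrite expnMn [leqRHS]mE leq_mul ?rough// IH ?ltn_Pdiv//.
by move=> r rp rq; apply: rough => //; rewrite mE dvdn_mulr.
Qed.

(** Prime factors from 2^k on cost nothing; each of the finitely many primes below 2^k costs a
    factor k^k, whatever its multiplicity. *)
Lemma size_divisors_bound k : 0 < k ->
  exists C, forall m, 0 < m -> size (divisors m) ^ k <= C * m.
Proof.
move=> k0.
suff [C CP] : exists C, forall m, 0 < m ->
    (forall p, prime p -> p %| m -> 2 ^ k <= p \/ p < 2 ^ k) ->
    size (divisors m) ^ k <= C * m.
  by exists C => m m0; apply: CP => // p _ _; lia.
(* Only the second [2 ^ k] becomes [B], so prime factors in [B, 2^k) are excluded. At [B = 0] all
   prime factors are at least 2^k; passing from [B] to [B.+1] matters only if [B] is prime. *)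
elim: {2}(2 ^ k) => [|B [C IH]].
  exists 1 => m m0 mP; rewrite mul1n; apply: rough_size_divisors => // p pp pm.
  by case: (mP p pp pm).
have [Bp|Bp] := boolP (prime B); last first.
  exists C => m m0 mP; apply: IH => // p pp pm.
  have pB : p != B by apply: contraNneq Bp => <-.
  by case: (mP p pp pm); lia.
exists (k ^ k * C) => m m0 mP.
have [m' cop mE] := pfactor_coprime Bp m0.
have m'0 : 0 < m' by move: m0; rewrite mE muln_gt0 => /andP[].
set a := logn B m in mE.
have Ba0 : 0 < B ^ a by rewrite expn_gt0 prime_gt0.
apply: (@leq_trans ((size (divisors m') * a.+1) ^ k)).
  rewrite leq_exp2r// [in leqLHS]mE.
  by apply: leq_trans (size_divisorsM _ _) _; rewrite ?leq_mul2l ?size_divisorsX ?orbT.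
rewrite expnMn mulnC -mulnA [in leqRHS]mE [m' * _]mulnC [C * _]mulnCA mulnA.
apply: leq_mul.
  apply: leq_trans (expn_le_exp2 a k0) _.
  by rewrite leq_mul2l; case: a {mE Ba0} => [|a]; rewrite ?orbT// leq_exp2r// prime_gt1 ?orbT.
apply: IH => // p pp pm'.
have pm : p %| m by rewrite mE dvdn_mulr.
have pB : p != B.
  by apply: contraTneq cop => <-; rewrite prime_coprime// pm'.
by case: (mP p pp pm); lia.
Qed.

Local Open Scope classical_set_scope.
Local Open Scope ring_scope.

(** * Greatest common divisors of differences of squares *)

Definition sqrdiff (N : nat) (p : 'I_N * 'I_N) : int :=
  (p.1.+1 ^ 2)%:Z - (p.2.+1 ^ 2)%:Z.

Lemma sqrdiff_fact N (p : 'I_N * 'I_N) :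
  `|sqrdiff p|%N = (`|p.1%:Z - p.2%:Z| * (p.1 + p.2 + 2))%N.
Proof.
rewrite -[(p.1 + p.2 + 2)%N]absz_nat -abszM; congr absz.
by rewrite /sqrdiff; nia.
Qed.

Lemma sqrdiff_gt0 N (p : 'I_N * 'I_N) : p.1 != p.2 -> (0 < `|sqrdiff p|)%N.
Proof.
by rewrite -val_eqE /= sqrdiff_fact muln_gt0 => ?; apply/andP; split; lia.
Qed.

Lemma sqrdiff_le N (p : 'I_N * 'I_N) : (`|sqrdiff p| <= N ^ 2)%N.
Proof.
have lt2 (i : 'I_N) : (i.+1 ^ 2 <= N ^ 2)%N by rewrite leq_exp2r.
by have := lt2 p.1; have := lt2 p.2; rewrite /sqrdiff; lia.
Qed.

(** A pair is determined by the order of its entries and the divisor |j - k| of [d], since the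
    cofactor then gives j + k. *)
Lemma card_sqrdiff N d : (0 < d)%N ->
  (#|[pred p : 'I_N * 'I_N | `|sqrdiff p|%N == d]| <= 2 * size (divisors d))%N.
Proof.
move=> d0; pose f (p : 'I_N * 'I_N) := ((p.1 < p.2)%N, `|p.1%:Z - p.2%:Z|%N).
rewrite cardE -(size_map f).
have <- : size [seq (b, e) | b <- [:: true; false], e <- divisors d]
    = (2 * size (divisors d))%N by rewrite size_allpairs.
apply: uniq_leq_size.
  rewrite map_inj_in_uniq ?enum_uniq// => -[j k] [j' k'].
  rewrite !mem_enum !inE /= !sqrdiff_fact /= => /eqP dE /eqP dE'.
  rewrite /f /= => -[b e].
  have u0 : (0 < `|j%:Z - k%:Z|)%N by move: d0; rewrite -dE muln_gt0 => /andP[].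
  have /eqP : (`|j%:Z - k%:Z| * (j + k + 2) = `|j%:Z - k%:Z| * (j' + k' + 2))%N.
    by rewrite dE {1}e dE'.
  rewrite eqn_pmul2l// => /eqP s.
  by congr pair; apply: val_inj => /=; lia.
move=> _ /mapP[p + ->]; rewrite mem_enum inE => /eqP dE.
apply/allpairsP; exists (f p); split => //=; first by case: ltnP.
by rewrite -dvdn_divisors// -dE sqrdiff_fact dvdn_mulr.
Qed.

(** Bound the gcd by the sum of all common divisors g and exchange the sums: each g dividing [m]
    occurs m / g times and contributes [m]. *)
Lemma sum_gcdn_le m : (0 < m)%N ->
  (\sum_(1 <= d < m.+1) gcdn d m <= m * size (divisors m))%N.
Proof.
move=> m0.
apply: (@leq_trans (\sum_(1 <= d < m.+1) \sum_(g <- divisors m | g %| d) g)%N).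
  rewrite !big_nat; apply: leq_sum => d /andP[d0 _].
  rewrite (big_rem (gcdn d m)) ?dvdn_gcdl ?leq_addr//=.
  by rewrite -dvdn_divisors// dvdn_gcdr.
rewrite (exchange_big_dep predT)//=.
have -> : (m * size (divisors m) = \sum_(g <- divisors m) m)%N.
  by rewrite big_const_seq count_predT iter_addn_0.
rewrite !big_seq; apply: leq_sum => g; rewrite -dvdn_divisors// => gm.
rewrite -[leqRHS](divnK gm) divn_count_dvd big_distrl /= big_mkcond.
by apply: leq_sum => d _; case: ifP => // _; rewrite mul1n.
Qed.

(** Group the pairs by d = |D_p|: each d arises from at most 2T pairs, and the gcds of d and [m] add
    up to at most mT. *)
Lemma sum_gcdn_sqrdiff_le N T m : (0 < m)%N ->
  (forall d, 0 < d <= m -> size (divisors d) <= T)%N ->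
  (\sum_(p : 'I_N * 'I_N | (p.1 != p.2) && (`|sqrdiff p| <= m))
     gcdn `|sqrdiff p| m <= 2 * T ^ 2 * m)%N.
Proof.
move=> m0 TP; pose D (p : 'I_N * 'I_N) : 'I_m.+1 := inord `|sqrdiff p|.
have DE p : (`|sqrdiff p| <= m)%N -> D p = `|sqrdiff p|%N :> nat.
  by move=> ?; rewrite inordK.
rewrite (partition_big D (fun d => 0 < d)%N); last first.
  by move=> p /andP[pp pm]; rewrite DE// sqrdiff_gt0.
apply: (@leq_trans (\sum_(d < m.+1 | (0 < d)%N) 2 * T * gcdn d m)%N).
  apply: leq_sum => d d0.
  apply: (@leq_trans (\sum_(p | p \in [pred p : 'I_N * 'I_N | `|sqrdiff p|%N == d]) gcdn d m)%N).
    rewrite [leqLHS]big_mkcond [leqRHS]big_mkcond; apply: leq_sum => p _ /=.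
    case: ifPn => // /andP[/andP[pp pm] /eqP pd].
    by rewrite inE -pd DE// eqxx.
  rewrite sum_nat_const leq_mul2r; apply/orP; right.
  apply: leq_trans (card_sqrdiff _ d0) _.
  by rewrite leq_mul2l TP// d0/= -ltnS.
rewrite -big_distrr/= -(big_mkord (fun d => 0 < d)%N (fun d => gcdn d m)).
rewrite big_mkcond big_ltn//= add0n.
apply: (@leq_trans (2 * T * (m * T))%N); last by rewrite mulnCA; nia.
rewrite leq_mul2l; apply/orP; right.
apply: leq_trans (_ : (m * size (divisors m) <= _)%N); last first.
  by rewrite leq_mul2l TP ?m0 ?leqnn ?orbT.
apply: leq_trans (sum_gcdn_le m0).
by rewrite [leqRHS]big_nat [leqLHS]big_nat; apply: leq_sum => d /andP[-> _].
Qed.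

(** A GCD sum: multiplied by h, it bounds the total correlation of the events attached to p and q
    beyond the independent value h^2. *)
Definition gcd_energy (R : realFieldType) (N : nat) : R :=
  \sum_(p : 'I_N * 'I_N | p.1 != p.2) \sum_(q : 'I_N * 'I_N | q.1 != q.2)
    (gcdn `|sqrdiff p| `|sqrdiff q|)%:R / (maxn `|sqrdiff p| `|sqrdiff q|)%:R.

(** The half of the sum with |D_q| <= |D_p| is at most 2T^2 for each fixed p, and there are at most
    N^2 choices of p; the other half is symmetric. *)
Lemma gcd_energy_le (R : realFieldType) N T :
  (forall d, 0 < d <= N ^ 2 -> size (divisors d) <= T)%N ->
  gcd_energy R N <= (4 * T ^ 2 * N ^ 2)%:R.
Proof.
move=> TP; pose D (p : 'I_N * 'I_N) := `|sqrdiff p|%N.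
pose g p q : R := if (D q <= D p)%N then (gcdn (D q) (D p))%:R / (D p)%:R else 0.
have g0 p q : 0 <= g p q by rewrite /g; case: ifP => // _; rewrite divr_ge0.
pose S := \sum_(p : 'I_N * 'I_N | p.1 != p.2)
            \sum_(q : 'I_N * 'I_N | q.1 != q.2) g p q.
have SP : S <= (2 * T ^ 2 * N ^ 2)%:R.
  apply: (@le_trans _ _ (\sum_(p : 'I_N * 'I_N) (2 * T ^ 2)%:R)); last first.
    by rewrite -natr_sum sum_nat_const card_prod card_ord -mulnn mulnC.
  rewrite /S big_mkcond; apply: ler_sum => p _; case: ifPn => // pp.
  have Dp0 := sqrdiff_gt0 pp.
  rewrite -big_mkcondr/= -mulr_suml ler_pdivrMr ?ltr0n//.
  rewrite -natr_sum -natrM ler_nat.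
  apply: sum_gcdn_sqrdiff_le => // d /andP[d0 dp].
  by apply: TP; rewrite d0 (leq_trans dp)// sqrdiff_le.
apply: (@le_trans _ _ (S + S)); last first.
  by apply: le_trans (lerD SP SP) _; rewrite -natrD ler_nat; lia.
rewrite {2}/S exchange_big -big_split; apply: ler_sum => p pp /=.
rewrite -big_split; apply: ler_sum => q qq /=.
rewrite -/(D p) -/(D q).
have [pq|/ltnW pq] := leqP (D p) (D q).
  by rewrite ler_wpDl// [leRHS]/g pq.
by rewrite ler_wpDr// [leRHS]/g pq gcdnC.
Qed.

(** * Equidistribution of arithmetic progressions modulo 1 *)

Lemma in_itv_add_int (R : realType) (A B x : R) :
  (x \in itv_add_int A B) <-> exists m : int, A <= x - m%:~R <= B.
Proof.
rewrite inE; split=> [[y /=]|[m mAB]].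
  by rewrite in_itv/= => yAB [m _ <-]; exists m; rewrite addrK.
by exists (x - m%:~R) => /=; rewrite ?in_itv//; exists m; rewrite ?subrK.
Qed.

Lemma itv_add_intD (R : realType) (A B x : R) (m : int) :
  (x + m%:~R \in itv_add_int A B) = (x \in itv_add_int A B).
Proof.
apply/idP/idP => /in_itv_add_int[n nAB]; apply/in_itv_add_int.
  by exists (n - m); rewrite rmorphB/= opprB addrA.
by exists (n + m); rewrite rmorphD/= opprD addrACA subrr addr0.
Qed.

Lemma itv_add_intN (R : realType) (A B x : R) :
  (- x \in itv_add_int A B) = (x \in itv_add_int (- B) (- A)).
Proof.
apply/idP/idP => /in_itv_add_int[n nAB]; apply/in_itv_add_int.
  by exists (- n); move: nAB; rewrite rmorphN/=; lra.
by exists (- n); move: nAB; rewrite rmorphN/=; lra.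
Qed.

Lemma ltn_eq_modz (a b q : nat) (m : int) :
  (a < q)%N -> (b < q)%N -> a%:Z = b%:Z + m * q%:Z -> a = b.
Proof.
move=> aq bq abE; have [m0|m0|m0] := ltrgtP m 0.
- suff : m * q%:Z <= - 1 * q%:Z by lia.
  by rewrite ler_wpM2r//; lia.
- suff : 1 * q%:Z <= m * q%:Z by lia.
  by rewrite ler_wpM2r//; lia.
by move: abE; rewrite m0; lia.
Qed.

(** The index i is a hit exactly when it is congruent modulo [q] to one of the L integers in
    [q(A - y), q(B - y)], and L differs from q(B - A) by at most 1. The map [f] sends these integers
    to their residues. *)
Lemma itv_add_int_equidistributed (R : realType) (A B y : R) (q : nat) :
  (0 < q)%N -> A <= B ->
  let S := \sum_(i < q) (y + i%:R / q%:R \in itv_add_int A B)%:R : R in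
  S <= q%:R * (B - A) + 1 /\ (B - A <= 1 -> q%:R * (B - A) - 1 <= S).
Proof.
move=> q0 AB S.
have qr0 : 0 < q%:R :> R by rewrite ltr0n.
pose n0 := Num.ceil (q%:R * (A - y)); pose n1 := Num.floor (q%:R * (B - y)).
have /andP[s1 s2] := ceil_itv (q%:R * (A - y)).
have /andP[t1 t2] := floor_itv (q%:R * (B - y)).
rewrite -/n0 -/n1 in s1 s2 t1 t2.
rewrite rmorphB/= in s1; rewrite rmorphD/= in t2.
have qAB : 0 <= q%:R * (B - A) by rewrite mulr_ge0 ?subr_ge0// ltW.
(* The window may contain no integer; then [n1 = n0 - 1] and the count is 0, never negative. *)
have L0 : 0 <= n1 - n0 + 1.
  rewrite -ltzD1 -(ltr0z R) !rmorphD/= rmorphN/=; lra.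
have [L LE] : exists L : nat, n1 - n0 + 1 = L%:Z.
  by exists `|(n1 - n0 + 1)%R|%N; lia.
have LR : L%:R = n1%:~R - n0%:~R + 1 :> R.
  by rewrite -[LHS]/((L%:Z)%:~R) -LE !rmorphD/= rmorphN.
have hitE (i : 'I_q) : (y + i%:R / q%:R \in itv_add_int A B) <->
    exists2 l : nat, (l < L)%N & exists m : int, i%:Z = n0 + l%:Z + m * q%:Z.
  rewrite in_itv_add_int; split=> [[m /andP[mA mB]]|[l lL [m mE]]].
    have iE : (i%:Z - m * q%:Z)%:~R = q%:R * (y + i%:R / q%:R - m%:~R - y) :> R.
      by rewrite rmorphB rmorphM/= -!pmulrn; field; lra.
    have h1 : n0 <= i%:Z - m * q%:Z.
      by rewrite ceil_le_int iE ler_pM2l// lerB.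
    have h2 : i%:Z - m * q%:Z <= n1.
      by rewrite floor_ge_int iE ler_pM2l// lerB.
    exists `|(i%:Z - m * q%:Z - n0)%R|%N; first lia.
    by exists m; lia.
  exists m; rewrite -(lerD2r (- y)) -[X in _ && X](lerD2r (- y)).
  rewrite -(ler_pM2l qr0) -[X in _ && X](ler_pM2l qr0).
  have -> : q%:R * (y + i%:R / q%:R - m%:~R - y) = (i%:Z - m * q%:Z)%:~R :> R.
    by rewrite rmorphB rmorphM/= -!pmulrn; field; lra.
  by rewrite -ceil_le_int -floor_ge_int -/n0 -/n1; apply/andP; split; lia.
have f_subproof (l : nat) : (`|((n0 + l%:Z) %% q%:Z)%Z| < q)%N by lia.
pose f (l : nat) : 'I_q := Ordinal (f_subproof l).
have fE l : exists m : int, (f l)%:Z = n0 + l%:Z + m * q%:Z.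
  by exists (- ((n0 + l%:Z) %/ q%:Z)%Z); rewrite /=; lia.
have SE : S = #|[set i : 'I_q | y + i%:R / q%:R \in itv_add_int A B]%SET|%:R.
  by rewrite /S -natr_sum -sum1dep_card [in RHS]big_mkcond.
have imE : [set i : 'I_q | y + i%:R / q%:R \in itv_add_int A B]%SET
    = [set f l | l : 'I_L]%SET.
  apply/setP => i; rewrite inE; apply/idP/imsetP => [/hitE[l lL [m mE]]|[l _ ->]].
    exists (Ordinal lL) => //; apply: val_inj.
    have [m' m'E] := fE l.
    by apply: (@ltn_eq_modz i (f l) q (m - m')); rewrite ?ltn_ord//; lia.
  by apply/hitE; exists l.
rewrite SE imE; split.
  apply: (@le_trans _ _ L%:R); last by lra.
  by rewrite ler_nat (leq_trans (leq_imset_card _ _))// card_ord.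
move=> h1.
have [Lq|qL] := leqP L q.
  rewrite card_imset ?card_ord; first lra.
  move=> l l' ll'; apply: val_inj => /=.
  have [m mE] := fE l; have [m' mE'] := fE l'.
  rewrite ll' in mE.
  by apply: (@ltn_eq_modz l l' q (m' - m)); rewrite ?(leq_trans (ltn_ord _))//; lia.
(* More than [q] consecutive integers cover every residue, so all [q] indices are hits, and q(B - A)
   <= q. *)
apply: (@le_trans _ _ q%:R).
  rewrite lerBlDr; apply: (@le_trans _ _ (q%:R * 1)); last lra.
  by rewrite ler_pM2l.
rewrite ler_nat -[leqLHS]card_ord -(card_imset (mem 'I_q) (f := f \o val)).
  apply: subset_leq_card; apply/fintype.subsetP => _ /imsetP[l _ ->].
  by apply/imsetP; exists (Ordinal (ltn_trans (ltn_ord l) qL)).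
move=> l l' ll'; apply: val_inj => /=.
have [m mE] := fE l; have [m' mE'] := fE l'.
rewrite -[f l]/((f \o val) l) ll' in mE.
by apply: (@ltn_eq_modz l l' q (m' - m)) => //; move: mE mE' => /=; lia.
Qed.

Lemma periodic_modn (T : Type) (f : nat -> T) (q : nat) :
  (forall i, f (i + q)%N = f i) -> forall i, f i = f (i %% q)%N.
Proof.
move=> fq i; rewrite {1}(divn_eq i q); elim: (i %/ q)%N => [//|k IH].
by rewrite mulSn addnC addnA addnAC fq addnC.
Qed.

Lemma sum_periodic (V : nmodType) (f : nat -> V) (q g : nat) :
  (forall i, f (i + q)%N = f i) ->
  \sum_(i < g * q) f i = (\sum_(i < q) f i) *+ g.
Proof.
move=> fq; elim: g => [|g IH]; first by rewrite mul0n big_ord0.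
rewrite mulSn big_split_ord/= mulrS -IH; congr (_ + _).
by apply: eq_bigr => i _; rewrite addnC fq.
Qed.

(** Multiplication by [c] permutes the residues modulo [q]. *)
Lemma sum_coprime_reindex (V : nmodType) (f : nat -> V) (q c : nat) :
  (0 < q)%N -> coprime c q -> (forall i, f (i + q)%N = f i) ->
  \sum_(i < q) f (c * i)%N = \sum_(i < q) f i.
Proof.
move=> q0 cq fq; pose h (i : 'I_q) : 'I_q := Ordinal (ltn_pmod (c * i) q0).
have hI : injective h.
  move=> i j /(congr1 val) /= /eqP; have [ij|/ltnW ij] := leqP i j => hij.
    apply: val_inj; apply/eqP; rewrite eqn_leq ij/= -subn_eq0.
    move: hij; rewrite eq_sym eqn_mod_dvd ?leq_mul2l ?ij ?orbT// -mulnBr.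
    rewrite Gauss_dvdr 1?coprime_sym// /dvdn modn_small//.
    by rewrite (leq_ltn_trans _ (ltn_ord j))// leq_subr.
  apply: val_inj; apply/eqP; rewrite eqn_leq ij/= andbT -subn_eq0.
  move: hij; rewrite eqn_mod_dvd ?leq_mul2l ?ij ?orbT// -mulnBr.
  rewrite Gauss_dvdr 1?coprime_sym// /dvdn modn_small//.
  by rewrite (leq_ltn_trans _ (ltn_ord i))// leq_subr.
rewrite [RHS](reindex_inj hI)/=.
by apply: eq_bigr => i _; rewrite (periodic_modn fq).
Qed.

(** Let g be the gcd of [c] and [q]. Modulo 1 the fractions c i / q run g times through the
    multiples of g / q, so the error 1 for a single run becomes g. A negative [c] is handled by
    reflecting [A, B]. *)
Lemma sum_itv_add_int (R : realType) (A B y : R) (c : int) (q : nat) :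
  (0 < q)%N -> A <= B ->
  let S := \sum_(i < q) (y + c%:~R * i%:R / q%:R \in itv_add_int A B)%:R : R in
  S <= q%:R * (B - A) + (gcdn `|c| q)%:R /\
  (B - A <= 1 -> q%:R * (B - A) - (gcdn `|c| q)%:R <= S).
Proof.
move=> q0; wlog [n ->] : A B y c / exists n : nat, c = n%:Z.
  move=> WL AB; have [c0|c0] := leP 0 c; first by apply: WL => //; exists `|c|%N; lia.
  have ex : exists n : nat, - c = n%:Z by exists `|c|%N; lia.
  have BA : - B <= - A by rewrite lerN2.
  have /= := WL (- B) (- A) (- y) (- c) ex BA.
  rewrite abszN opprK (addrC (- A)).
  under eq_bigr => i _ do
    rewrite -itv_add_intN opprD opprK rmorphN !mulNr opprK.
  by [].
move=> AB; rewrite absz_nat; set g := gcdn n q.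
have g0 : (0 < g)%N by rewrite gcdn_gt0 q0 orbT.
have [gn gq] : (g %| n /\ g %| q)%N by rewrite dvdn_gcdl dvdn_gcdr.
set e := (q %/ g)%N; have qE : q = (g * e)%N by rewrite mulnC divnK.
have e0 : (0 < e)%N by rewrite divn_gt0// dvdn_leq.
have cop : coprime (n %/ g) e.
  by rewrite /coprime -(eqn_pmul2r g0) mul1n muln_gcdl !divnK.
have qR : q%:R = g%:R * e%:R :> R by rewrite {1}qE natrM.
have nR : n%:R = (n %/ g)%:R * g%:R :> R by rewrite -natrM divnK.
pose f (i : nat) : R := (y + i%:R / e%:R \in itv_add_int A B)%:R.
have fe i : f (i + e)%N = f i.
  rewrite /f natrD mulrDl divff ?pnatr_eq0 -?lt0n// addrA.
  by rewrite -[1]/(1%:~R) itv_add_intD.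
have -> : \sum_(i < q) (y + n%:Z%:~R * i%:R / q%:R \in itv_add_int A B)%:R
    = (\sum_(i < e) (y + i%:R / e%:R \in itv_add_int A B)%:R) *+ g :> R.
  rewrite -[RHS]/((\sum_(i < e) f i) *+ g) -(sum_coprime_reindex e0 cop fe).
  rewrite -(@sum_periodic _ (fun i => f (n %/ g * i)%N) e); last first.
    move=> i; rewrite mulnDr (periodic_modn fe) [in RHS](periodic_modn fe).
    by rewrite addnC modnMDl.
  rewrite -qE; apply: eq_bigr => i _; 
  suff -> : n%:Z%:~R * i%:R / q%:R = (n %/ g * i)%:R / e%:R :> R by [].
  have gN : g%:R != 0 :> R by rewrite pnatr_eq0 -lt0n.
  rewrite natrM -!pmulrn nR qR.
  field.
  by rewrite gN pnatr_eq0 -lt0n e0.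
have [up lo] := itv_add_int_equidistributed y e0 AB.
move=> S.
have gr0 : 0 <= g%:R :> R by [].
have -> : S = (\sum_(i < e) (y + i%:R / e%:R \in itv_add_int A B)%:R) * g%:R.
  by rewrite mulr_natr.
split=> [|/lo{}lo]; rewrite qR.
  apply: le_trans (ler_wpM2r gr0 up) _; lra.
apply: le_trans (ler_wpM2r gr0 lo); lra.
Qed.

(** Write i = r + s Q with Q = M / |c|. The part s moves the argument of [c] by an integer and that
    of [d] by d s / |c|, so the sum over s is bounded uniformly in r. What remains is the count for
    [c] over r, where the step is 1 / Q up to sign. *)
Lemma sum_pair_itv_add_int (R : realType) (A B x : R) (c d : int) (M : nat) :
  (0 < M)%N -> (0 < `|c|)%N -> (`|c| %| M)%N -> A <= B ->
  \sum_(i < M) (c%:~R * (x + i%:R / M%:R) \in itv_add_int A B)%:R *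
               (d%:~R * (x + i%:R / M%:R) \in itv_add_int A B)%:R
  <= ((M %/ `|c|)%:R * (B - A) + 1)
     * (`|c|%:R * (B - A) + (gcdn `|d| `|c|)%:R) :> R.
Proof.
move=> M0 c0 cM AB; set D := `|c|%N; set Q := (M %/ D)%N.
have ME : M = (D * Q)%N by rewrite mulnC divnK.
have Q0 : (0 < Q)%N by rewrite divn_gt0// dvdn_leq.
have DN : D%:R != 0 :> R by rewrite pnatr_eq0 -lt0n.
have QN : Q%:R != 0 :> R by rewrite pnatr_eq0 -lt0n.
have MR : M%:R = D%:R * Q%:R :> R by rewrite {1}ME natrM.
have cE : c%:~R = (sgz c)%:~R * D%:R :> R by rewrite {1}(intEsg c) rmorphM.
pose F k i : R := (k%:~R * (x + i%:R / M%:R) \in itv_add_int A B)%:R.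
rewrite -(big_mkord predT (fun i => F c i * F d i)) {1}ME big_nat_mul.
under eq_bigr => s _ do rewrite -{1}(add0n (s * Q)%N) mulSn big_addn addnK.
rewrite exchange_big/= big_mkord.
have FcE r s : F c (r + s * Q)%N = F c r.
  rewrite /F -[in RHS](itv_add_intD _ _ _ (sgz c * s%:Z)).
  suff -> : c%:~R * (x + (r + s * Q)%:R / M%:R)
      = c%:~R * (x + r%:R / M%:R) + (sgz c * s%:Z)%:~R :> R by [].
  rewrite cE MR natrD natrM rmorphM/= -pmulrn.
  field.
  by rewrite DN QN.
have FdE r s : F d (r + s * Q)%N
    = (d%:~R * (x + r%:R / M%:R) + d%:~R * s%:R / D%:R \in itv_add_int A B)%:R.
  rewrite /F.
  suff -> : d%:~R * (x + (r + s * Q)%:R / M%:R)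
      = d%:~R * (x + r%:R / M%:R) + d%:~R * s%:R / D%:R :> R by [].
  rewrite MR natrD natrM.
  field.
  by rewrite DN QN.
apply: (@le_trans _ _ ((\sum_(r < Q) F c r) *
    (D%:R * (B - A) + (gcdn `|d| D)%:R))).
  rewrite mulr_suml; apply: ler_sum => r _; rewrite big_mkord.
  under eq_bigr => s _ do rewrite FcE FdE.
  rewrite -mulr_sumr ler_wpM2l//.
  by have [] := sum_itv_add_int (d%:~R * (x + r%:R / M%:R)) d c0 AB.
rewrite ler_wpM2r//.
  by rewrite addr_ge0// mulr_ge0// subr_ge0.
have [+ _] := sum_itv_add_int (c%:~R * x) (sgz c) Q0 AB.
have -> : `|sgz c|%N = 1%N by move: c0; clear; case: (sgzP c); lia.
rewrite gcd1n; apply: le_trans; apply: ler_sum => r _; rewrite /F.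
suff -> : c%:~R * (x + r%:R / M%:R) = c%:~R * x + (sgz c)%:~R * r%:R / Q%:R by [].
rewrite cE MR; field.
by rewrite DN QN.
Qed.

(** * Variance over rational translates *)

Definition sqr_pair_hits (R : realType) (A B : R) (N : nat) (x : R) : R :=
  \sum_(p : 'I_N * 'I_N | p.1 != p.2)
    ((sqrdiff p)%:~R * x \in itv_add_int A B)%:R.

Lemma pair_count_sqr (R : realType) (sigma a b x : R) (N : nat) :
  (pair_count sigma a b (fun n => x * n%:R ^+ 2) N)%:R
    = sqr_pair_hits (a / N%:R `^ sigma) (b / N%:R `^ sigma) N x.
Proof.
rewrite /pair_count /sqr_pair_hits -natr_sum -big_mkcondr/= sum1_card.
congr _%:R; apply: eq_card => p; rewrite !inE /=; congr (_ && _).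
suff -> : x * p.1.+1%:R ^+ 2 - x * p.2.+1%:R ^+ 2 = (sqrdiff p)%:~R * x by [].
by rewrite /sqrdiff rmorphB/= -!pmulrn !natrX; ring.
Qed.

Lemma card_offdiag N : #|[pred p : 'I_N * 'I_N | p.1 != p.2]| = (N ^ 2 - N)%N.
Proof.
have := cardC [pred p : 'I_N * 'I_N | p.1 == p.2].
rewrite card_prod card_ord mulnn => <-.
have -> : #|[pred p : 'I_N * 'I_N | p.1 == p.2]| = N.
  have diagI : injective (fun i : 'I_N => (i, i)) by move=> i j [].
  rewrite -[RHS](card_ord N) -(card_codom diagI); apply: eq_card => -[i j].
  by rewrite inE/=; apply/eqP/codomP => [->|[k [-> ->]]//]; exists j.
by rewrite addKn; apply: eq_card.
Qed.

(** Expand the square, with a lower bound for the first moment, which enters negatively, and an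
    upper bound for the second. The factorial makes every |D_p| divide [M]; the size of [M] lets the
    summand 1 absorb all rounding errors. *)
Lemma sqr_pair_hits_variance (R : realType) (A B x : R) (N M : nat) :
  A <= B -> B - A <= 1 -> ((N ^ 2)`! %| M)%N -> (4 * N ^ 6 <= M)%N -> (0 < M)%N ->
  \sum_(i < M) (sqr_pair_hits A B N (x + i%:R / M%:R)
                - (N ^ 2 - N)%N%:R * (B - A)) ^+ 2
  <= M%:R * ((B - A) * gcd_energy R N + 1).
Proof.
move=> AB h1 factM MN M0; set h := B - A in h1 *; set n2 : R := (N ^ 2 - N)%N%:R.
have h0 : 0 <= h by rewrite subr_ge0.
have MR : 0 < M%:R :> R by rewrite ltr0n.
pose P (p : 'I_N * 'I_N) := p.1 != p.2.
pose D (p : 'I_N * 'I_N) := `|sqrdiff p|%N.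
have DM p : P p -> (D p %| M)%N.
  move=> pp; apply: dvdn_trans factM; apply: dvdn_fact.
  by rewrite sqrdiff_gt0//= sqrdiff_le.
pose y (i : 'I_M) : R := x + i%:R / M%:R.
pose F (p : 'I_N * 'I_N) i : R := ((sqrdiff p)%:~R * y i \in itv_add_int A B)%:R.
pose S i := sqr_pair_hits A B N (y i).
have sumP (c : R) : \sum_(p : 'I_N * 'I_N | P p) c = n2 * c.
  rewrite mulr_natl -card_offdiag -sumr_const.
  by apply: eq_bigl => p; rewrite inE.
have N2 p : (D p)%:R <= (N ^ 2)%:R :> R by rewrite ler_nat sqrdiff_le.
have S1 : n2 * (M%:R * h - (N ^ 2)%:R) <= \sum_i S i.
  rewrite /S /sqr_pair_hits exchange_big/= -sumP; apply: ler_sum => p pp.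
  have [_ /(_ h1)] := sum_itv_add_int ((sqrdiff p)%:~R * x) (sqrdiff p) M0 AB.
  rewrite (gcdn_idPl (DM _ pp)) -/h => lo.
  apply: (@le_trans _ _ (M%:R * h - (D p)%:R)); first by rewrite lerB.
  apply: le_trans lo _; apply: ler_sum => i _.
  by rewrite mulrDr mulrA.
have S2 : \sum_i (S i) ^+ 2
    <= n2 * (n2 * (M%:R * h ^+ 2 + 2 * (N ^ 2)%:R)) + M%:R * h * gcd_energy R N.
  have -> : \sum_i (S i) ^+ 2
      = \sum_(p | P p) \sum_(q | P q) \sum_i F p i * F q i.
    under eq_bigr => i _ do rewrite expr2 /S /sqr_pair_hits mulr_suml.
    rewrite exchange_big/=; apply: eq_bigr => p _.
    rewrite exchange_big/=; apply: eq_bigr => i _.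
    by rewrite mulr_sumr.
  rewrite /gcd_energy mulr_sumr -sumP -big_split/=; apply: ler_sum => p pp.
  rewrite mulr_sumr -sumP -big_split/=; apply: ler_sum => q qq.
  rewrite -/(D p) -/(D q).
  (* By symmetry the period is taken from the pair with the larger difference, which puts the
     maximum in the denominator. *)
  wlog pq : p q pp qq / (D q <= D p)%N.
    move=> WL; case/orP: (leq_total (D q) (D p)); first exact: WL.
    move=> /(WL _ _ qq pp); rewrite gcdnC maxnC.
    by under eq_bigr => i _ do rewrite mulrC.
  rewrite (maxn_idPl pq).
  have Dp0 : (0 < D p)%N := sqrdiff_gt0 pp.
  apply: le_trans (sum_pair_itv_add_int x (sqrdiff q) M0 Dp0 (DM _ pp) AB) _.
  rewrite -/(D p) -/(D q) -/h natf_div ?DM// gcdnC.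
  have gN : (gcdn (D p) (D q))%:R <= (N ^ 2)%:R :> R.
    by apply: le_trans (N2 p); rewrite ler_nat dvdn_leq// dvdn_gcdl.
  have DpR : (D p)%:R != 0 :> R by rewrite pnatr_eq0 -lt0n.
  (* The three terms are the independent value, a rounding error of at most 2N^2, and the
     correlation. *)
  have -> : (M%:R / (D p)%:R * h + 1) * ((D p)%:R * h + (gcdn (D p) (D q))%:R)
     = M%:R * h ^+ 2 + ((D p)%:R * h + (gcdn (D p) (D q))%:R)
       + M%:R * h * ((gcdn (D p) (D q))%:R / (D p)%:R) :> R.
    by field.
  rewrite lerD2r lerD2l mulrDl mul1r lerD//.
  by apply: le_trans (N2 p); rewrite ler_piMr.
have n20 : 0 <= n2 by [].
have n2N : n2 <= (N ^ 2)%:R by rewrite ler_nat leq_subr.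
have -> : \sum_i (S i - n2 * h) ^+ 2
    = \sum_i (S i) ^+ 2 - 2 * (n2 * h) * (\sum_i S i) + M%:R * (n2 * h) ^+ 2.
  rewrite mulr_sumr -sumrB.
  have -> : M%:R * (n2 * h) ^+ 2 = \sum_(i < M) (n2 * h) ^+ 2.
    by rewrite sumr_const card_ord mulr_natl.
  by rewrite -big_split/=; apply: eq_bigr => i _; ring.
have : 2 * (n2 * h) * (n2 * (M%:R * h - (N ^ 2)%:R)) <= 2 * (n2 * h) * (\sum_i S i).
  by rewrite ler_wpM2l// !mulr_ge0.
have n2h : n2 ^+ 2 * (2 + 2 * h) * (N ^ 2)%:R <= M%:R.
  apply: (@le_trans _ _ ((N ^ 2)%:R ^+ 2 * 4 * (N ^ 2)%:R)); last first.
    by rewrite -natrX -!natrM ler_nat; apply: leq_trans MN; rewrite -!expnM; lia.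
  rewrite ler_wpM2r// ler_pM ?exprn_ge0//; first lra.
    by rewrite lerXn2r// nnegrE.
  by lra.
by move: S1 S2; set E := gcd_energy R N; nra.
Qed.

(** * Averaging over translates *)

Lemma measurable_addr (R : realType) (c : R) :
  measurable_fun setT ((+%R^~ c) : measurableTypeR R -> measurableTypeR R).
Proof. by apply: measurable_funD => //; exact: measurable_cst. Qed.

(** The pushforward under translation agrees with Lebesgue measure on half-open intervals, hence
    everywhere. *)
Lemma lebesgue_measure_translate (R : realType) (c : R) (A : set R) :
  measurable A -> lebesgue_measure ((+%R^~ c) @^-1` A) = lebesgue_measure A.
Proof.
pose f : measurableTypeR R -> measurableTypeR R := +%R^~ c.
have mf : measurable_fun setT f := measurable_addr c.
pose fM := HB.pack_for {mfun measurableTypeR R >-> measurableTypeR R} f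
  (isMeasurableFun.Build _ _ _ _ f mf).
move=> mA; rewrite -[LHS]/(pushforward lebesgue_measure fM A).
apply/esym/lebesgue_measure_unique => //= _ [[a b]] _ <-.
have -> : pushforward lebesgue_measure f `]a, b]
    = lebesgue_measure (`]a - c, b - c] : set R).
  congr lebesgue_measure; apply/seteqP; split=> x;
    by rewrite /f /= !in_itv/= ltrBlDr lerBrDr.
rewrite !lebesgue_measure_itv/= !lte_fin ltrD2r.
by case: ifP => // _; rewrite -!EFinB opprB addrA subrK.
Qed.

(** Cut [c, c + 1) into [M] cells of length 1/M and move each back to the first cell [J]. The
    measure becomes at most the integral over [J] of the number of translates in [B], which is at
    most M eta. *)
Lemma lebesgue_measure_average_le (R : realType) (B : set R) (c eta : R) (M : nat) :
  measurable B -> (0 < M)%N ->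
  (forall x, \sum_(i < M) \1_B (x + i%:R / M%:R) <= M%:R * eta) ->
  (lebesgue_measure (B `&` `[c, (c + 1)%R[) <= eta%:E)%E.
Proof.
move=> mB M0 avg.
have MR : 0 < M%:R :> R by rewrite ltr0n.
have MN : M%:R != 0 :> R by rewrite gt_eqF.
pose J : set R := `[c, c + M%:R^-1[%classic.
pose sh (i : nat) (x : R) := x + i%:R / M%:R.
pose G (i : nat) := sh i @^-1` B `&` J.
have mG i : measurable (sh i @^-1` B).
  by rewrite -[X in measurable X]setTI; exact: (measurable_addr (i%:R / M%:R)).
pose F (i : nat) : set R := B `&` `[c + i%:R / M%:R, c + i.+1%:R / M%:R[%classic.
have FG i : lebesgue_measure (F i) = lebesgue_measure (G i).
  rewrite -[LHS](lebesgue_measure_translate (i%:R / M%:R)); last first.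
    by apply: measurableI.
  congr lebesgue_measure; rewrite /F /G preimage_setI; congr (_ `&` _).
  apply/seteqP; split=> x; rewrite /J /= !in_itv/= lerD2r; case/andP=> -> /=;
    rewrite -natr1 mulrDl mul1r; lra.
apply: (@le_trans _ _ (\sum_(i < M) lebesgue_measure (F i))%E).
  apply: content_subadditive => //.
  - by move=> i _; apply: measurableI.
  - by apply: measurableI.
  move=> x [Bx]; rewrite /= in_itv/= => /andP[cx xc].
  have t0 : 0 <= (x - c) * M%:R by rewrite mulr_ge0// subr_ge0.
  have /andP[k1 k2] := truncn_itv t0.
  set k := Num.truncn _ in k1 k2.
  have kM : (k < M)%N.
    by rewrite -(ltr_nat R); apply: le_lt_trans k1 _; rewrite -ltr_pdivlMr// divff//; lra.
  rewrite (bigD1 (Ordinal kM))//=; left; split => //=; rewrite in_itv/=.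
  apply/andP; split.
    by rewrite -lerBrDl ler_pdivrMr.
  by rewrite -ltrBlDl ltr_pdivlMr.
have mJ : measurable J by exact: measurable_itv.
have FI i : lebesgue_measure (F i)
    = (\int[lebesgue_measure]_(x in J) (\1_(sh i @^-1` B) x)%:E)%E.
  rewrite FG integral_indic; [by []|exact: mJ|exact: mG].
under eq_bigr => i _ do rewrite FI.
rewrite -ge0_integral_sum//; last first.
  move=> i; apply/measurable_EFinP/measurable_indic; exact: mG.
apply: (@le_trans _ _ (\int[lebesgue_measure]_(x in J) (M%:R * eta)%:E)%E).
  apply: ge0_le_integral => //.
  - by move=> x _; apply: sume_ge0 => i _; rewrite lee_fin.
  - apply: emeasurable_sum => i; apply/measurable_EFinP; apply: measurable_indic; exact: mG.
  move=> x _; rewrite sumEFin lee_fin.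
  by apply: le_trans (avg x).
have muJ : lebesgue_measure J = (M%:R^-1)%:E.
  rewrite /J lebesgue_measure_itv/= lte_fin ltrDl invr_gt0 MR.
  by rewrite -EFinB addrAC subrr add0r.
rewrite integral_cst; last exact: mJ.
by rewrite [X in (_ * X)%E]muJ -EFinM lee_fin mulrAC divff// mul1r.
Qed.

(** Chebyshev's inequality for the average over translates, at every x, carried over to Lebesgue
    measure on a unit interval. *)
Lemma lebesgue_measure_chebyshev (R : realType) (S : R -> R) (c m t V : R) (M : nat) :
  measurable_fun setT S -> 0 < t -> (0 < M)%N ->
  (forall x, \sum_(i < M) (S (x + i%:R / M%:R) - m) ^+ 2 <= M%:R * V) ->
  (lebesgue_measure ([set x | (t <= `|S x - m|)%R] `&` `[c, (c + 1)%R[)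
     <= (V / t ^+ 2)%:E)%E.
Proof.
move=> mS t0 M0 var; apply: (@lebesgue_measure_average_le _ _ _ _ M) => //.
  rewrite -[X in measurable X]setTI.
  apply: (@measurable_fun_le _ _ _ setT (cst t) (fun x => `|S x - m|)) => //.
  by apply: measurableT_comp => //; apply: measurable_funB.
move=> x; rewrite mulrA ler_pdivlMr ?exprn_gt0// mulr_suml.
apply: le_trans (var x); apply: ler_sum => i _.
rewrite indicE; have [|_] := boolP (_ \in _); last by rewrite mul0r sqr_ge0.
rewrite inE/= => tS; rewrite mul1r -[leRHS]real_normK ?num_real//.
by rewrite lerXn2r// nnegrE// ltW.
Qed.

(** * Almost sure convergence along eighth powers *)

Lemma measurable_itv_add_int (R : realType) (A B : R) :
  measurable (itv_add_int A B).
Proof.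
have -> : itv_add_int A B = \bigcup_(m : int) `[A + m%:~R, B + m%:~R]%classic.
  apply/seteqP; split=> [x xAB|x [m _]]; last first.
    rewrite /= in_itv/= => mx; apply: set_mem; apply/in_itv_add_int; exists m; lra.
  have /in_itv_add_int[m mx] := mem_set xAB.
  by exists m => //=; rewrite in_itv/=; lra.
apply: countable_bigcupT_measurable; first exact: countableP.
by move=> m; exact: measurable_itv.
Qed.

Lemma measurable_sqr_pair_hits (R : realType) (A B : R) (N : nat) :
  measurable_fun setT (sqr_pair_hits A B N).
Proof.
pose E (p : 'I_N * 'I_N) := ( *%R (sqrdiff p)%:~R) @^-1` itv_add_int A B.
have -> : sqr_pair_hits A B N
    = fun x => \sum_(p <- [seq p <- index_enum _ | p.1 != p.2]) \1_(E p) x.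
  by apply/funext => x; rewrite big_filter.
apply: measurable_sum => p.
apply: measurable_indic; rewrite -[X in measurable X]setTI.
have := @mulrl_measurable R setT (sqrdiff p)%:~R.
apply => //; exact: measurable_itv_add_int.
Qed.

(** The Borel-Cantelli lemma, applied on each unit interval [i, i + 1) with integer i because the
    measure bounds are local; countably many null sets are then united. *)
Lemma ae_eventually_notin (R : realType) (F : nat -> set R) (C : R) :
  (forall k, measurable (F k)) ->
  (forall k (c : R), (lebesgue_measure (F k `&` `[c, (c + 1)%R[)
                       <= (C / k.+1%:R ^+ 2)%:E)%E) ->
  {ae (@lebesgue_measure R), forall x, \forall k \near \oo, ~ F k x}.
Proof.
move=> mF muF.
(* This enumerates the integers; codes of no integer give 0, which only repeats an interval. *)
pose c (i : nat) : R := (odflt 0 (unpickle i : option int))%:~R.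
pose G i k := F k `&` `[c i, (c i + 1)%R[%classic.
have mG i k : measurable (G i k) by apply: measurableI.
have C0 : 0 <= C.
  have := muF 0%N 0; rewrite expr1n divr1 -lee_fin; apply: le_trans.
  exact: measure_ge0.
(* Telescoping: 1 / (k + 1)^2 <= 2 / (k + 1) - 2 / (k + 2). *)
have sum_inv n : \sum_(0 <= k < n) C / k.+1%:R ^+ 2 <= C * (2 - 2 / n.+1%:R).
  elim: n => [|n IH]; first by rewrite big_geq// divr1 subrr mulr0.
  rewrite big_nat_recr//=; apply: le_trans (lerD IH (lexx _)) _.
  rewrite -mulrDr ler_wpM2l//.
  have n0 : 0 <= n%:R :> R by [].
  rewrite -(natr1 n.+1) -(natr1 n); set y : R := n%:R in n0 *.
  rewrite -subr_ge0.
  have -> : 2 - 2 / (y + 1 + 1) - (2 - 2 / (y + 1) + ((y + 1) ^+ 2)^-1)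
     = y / ((y + 1) ^+ 2 * (y + 2)) by field; lra.
  by rewrite divr_ge0// mulr_ge0// ?sqr_ge0//; lra.
have null i : lebesgue_measure (lim_sup_set (G i)) = 0.
  apply: lim_sup_set_cvg0; first exact: mG.
  apply: (@le_lt_trans _ _ (C * 2)%:E); last by rewrite ltry.
  apply: lime_le; first by apply: is_cvg_nneseries => n _ _; exact: measure_ge0.
  apply: nearW => n.
  apply: (@le_trans _ _ (\sum_(0 <= k < n) C / k.+1%:R ^+ 2)%:E).
    by rewrite -sumEFin; apply: lee_sum => k _; exact: muF.
  rewrite lee_fin; apply: le_trans (sum_inv n) _.
  by rewrite ler_wpM2l// gerBl.
have : (@lebesgue_measure R).-negligible (\bigcup_i lim_sup_set (G i)).
  apply: negligible_bigcup => i; apply/negligibleP; last exact: null.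
  apply: bigcapT_measurable => n; apply: bigcup_measurable => k _; exact: mG.
apply: negligibleS.
move=> x /= xF.
exists (pickle (Num.floor x)) => // n _.
have /andP[x1 x2] := floor_itv x.
apply: contrapT => nG; apply: xF; exists n => // k /= nk Fk; apply: nG.
exists k => //; split=> //=; rewrite in_itv/= /c pickleK/= x1/=.
by rewrite rmorphD/= in x2.
Qed.

(** For d <= N^2 = n^16 the bound tau(d)^8 <= C d gives tau(d) <= C n^2, so that 4 T^2 N^2 is 4 C^2
    n^(4 + 16). *)
Lemma gcd_energy_pow8 (R : realFieldType) :
  exists C : R, forall n : nat, gcd_energy R (n ^ 8) <= C * n%:R ^+ 20.
Proof.
have [C CP] := size_divisors_bound (isT : (0 < 8)%N).
exists (4 * C ^ 2)%N%:R => n.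
have tau d : (0 < d <= (n ^ 8) ^ 2 -> size (divisors d) <= C * n ^ 2)%N.
  move=> /andP[d0 dn]; rewrite -(leq_exp2r _ _ (isT : (0 < 8)%N)).
  apply: leq_trans (CP _ d0) _; rewrite expnMn -expnM.
  apply: leq_mul; last by rewrite -expnM in dn.
  by case: C {CP} => // C; rewrite -[leqLHS]expn1 leq_pexp2l.
apply: le_trans (gcd_energy_le _ tau) _.
rewrite -natrX -natrM ler_nat expnMn -!expnM.
by rewrite mulnA -mulnA -expnD.
Qed.

(** With n = k + 1, N = n^8 and u = N^sigma, the variance is O(n^20 / u + 1) and the squared
    threshold is d^2 n^32 / u^2. Since sigma <= 5/4 means u <= n^10, the quotient is O(n^30 / n^32),
    which is summable. *)
Lemma ae_R2_pow8 (R : realType) (sigma a b : R) :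
  0 <= sigma -> sigma <= 5 / 4 -> a <= b -> (sigma = 0 -> b - a <= 1) ->
  {ae (@lebesgue_measure R), forall x,
    R2 sigma a b (fun n => x * n%:R ^+ 2) (k.+1 ^ 8) @[k --> \oo] --> b - a}.
Proof.
move=> s0 s1 ab sab; have ba0 : 0 <= b - a by rewrite subr_ge0.
have [W WP] := gcd_energy_pow8 R.
have W0 : 0 <= W.
  have := WP 1%N; rewrite expr1n mulr1; apply: le_trans.
  by apply: sumr_ge0 => p _; apply: sumr_ge0 => q _; rewrite divr_ge0.
pose N (k : nat) := (k.+1 ^ 8)%N.
pose u (k : nat) : R := (N k)%:R `^ sigma.
pose n (k : nat) : R := k.+1%:R.
have n1 k : 1 <= n k by rewrite ler1n.
have NE k : (N k)%:R = n k ^+ 8 :> R by rewrite natrX.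
have N1 k : 1 <= (N k)%:R :> R by rewrite NE exprn_ege1.
have N0 k : 0 < (N k)%:R :> R by rewrite (lt_le_trans _ (N1 k)).
have u1 k : 1 <= u k by rewrite -(powRr0 (N k)%:R) ler_powR.
have u0 k : 0 < u k by rewrite (lt_le_trans _ (u1 k)).
have un k : u k <= n k ^+ 10.
  rewrite /u NE -!powR_mulrn ?(le_trans ler01)// -powRrM ler_powR//; lra.
have powE k : (N k)%:R `^ (2 - sigma) = (N k)%:R ^+ 2 / u k.
  rewrite powRB; last by apply/implyP => _; rewrite gt_eqF.
  by rewrite -[in RHS]powR_mulrn// ltW.
pose h k := b / u k - a / u k.
have hE k : h k = (b - a) / u k by rewrite /h mulrBl.
have ABk k : a / u k <= b / u k by rewrite ler_pM2r ?invr_gt0.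
pose S k (x : R) := sqr_pair_hits (a / u k) (b / u k) (N k) x.
pose m k : R := (N k ^ 2 - N k)%N%:R * h k.
(* The variance bound requires [h k <= 1]. This holds for all large [k] by [hle1], so the sets for
   other [k] are made empty. *)
pose bad (d : R) k : set R := if h k <= 1
  then [set x | d * ((N k)%:R ^+ 2 / u k) <= `|S k x - m k| ] else set0.
have bad_ae (d : R) : 0 < d ->
    {ae (@lebesgue_measure R), forall x, \forall k \near \oo, ~ bad d k x}.
  move=> d0.
  apply: (@ae_eventually_notin _ _ (((b - a) * W + 1) / d ^+ 2)).
    move=> k; rewrite /bad; case: ifP => _; last exact: measurable0.
    rewrite -[X in measurable X]setTI.
    apply: (@measurable_fun_le _ _ _ setT (cst (d * ((N k)%:R ^+ 2 / u k)))
      (fun x => `|S k x - m k|)) => //.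
    apply: measurableT_comp => //; apply: measurable_funB => //.
    exact: measurable_sqr_pair_hits.
  move=> k c; rewrite /bad; case: ifPn => hk; last first.
    rewrite set0I measure0 lee_fin !divr_ge0// ?sqr_ge0// addr_ge0// mulr_ge0//.
  have t0 : 0 < d * ((N k)%:R ^+ 2 / u k) by rewrite mulr_gt0// divr_gt0// exprn_gt0.
  (* The factorial supplies the divisibility and the other factor the size demanded by the variance
     bound. *)
  pose M := (4 * N k ^ 6 * (N k ^ 2)`!)%N.
  have f0 : (0 < (N k ^ 2)`!)%N by rewrite fact_gt0.
  have M0 : (0 < M)%N by rewrite muln_gt0 f0 andbT muln_gt0 !expn_gt0.
  have var x := @sqr_pair_hits_variance R (a / u k) (b / u k) x (N k) M (ABk k) hk
    (dvdn_mull _ (dvdnn _)) (leq_pmulr _ f0) M0.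
  apply: le_trans (lebesgue_measure_chebyshev c (measurable_sqr_pair_hits _ _ _)
    t0 M0 var) _.
  rewrite -/(h k) hE lee_fin.
  rewrite ler_pdivrMr ?exprn_gt0//.
  have -> : ((b - a) * W + 1) / d ^+ 2 / k.+1%:R ^+ 2 * (d * ((N k)%:R ^+ 2 / u k)) ^+ 2
     = ((b - a) * W + 1) * n k ^+ 30 / u k ^+ 2.
    rewrite NE -/(n k); field.
    by rewrite !gt_eqF// (lt_le_trans ltr01).
  rewrite ler_pdivlMr ?exprn_gt0//.
  have -> : ((b - a) / u k * gcd_energy R (N k) + 1) * u k ^+ 2
     = (b - a) * (gcd_energy R (N k) * u k) + u k ^+ 2 by field; rewrite gt_eqF.
  rewrite [leRHS]mulrDl mul1r; apply: lerD.
    rewrite -mulrA ler_wpM2l// (_ : 30 = 20 + 10)%N// exprD mulrA.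
    apply: ler_pM (WP _) (un k) => //; last exact: ltW.
    by apply: sumr_ge0 => p _; apply: sumr_ge0 => q _; rewrite divr_ge0.
  apply: (@le_trans _ _ ((n k ^+ 10) ^+ 2)).
    by rewrite lerXn2r// nnegrE ?exprn_ge0// ?(le_trans ler01)// ltW.
  by rewrite -exprM ler_weXn2l.
have hle1 : \forall k \near \oo, h k <= 1.
  have [s00|sN0] := eqVneq sigma 0.
    apply: nearW => k; rewrite hE /u s00 powRr0 divr1; exact: sab.
  have : \forall k \near \oo, (b - a) `^ sigma^-1 <= k%:R by exact: nbhs_infty_ger.
  apply: filterS => k kab; rewrite hE ler_pdivrMr// mul1r.
  rewrite -[leLHS](powRr1 ba0) -(mulVf sN0) powRrM ge0_ler_powR ?nnegrE ?powR_ge0//.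
  apply: (le_trans kab); rewrite NE.
  by apply: (@le_trans _ _ (n k)); [rewrite ler_nat | rewrite ler_eXnr].
(* The countably many tolerances 1 / (j + 1) keep the exceptional set null. *)
have /ae_foralln : forall j : nat, {ae (@lebesgue_measure R), forall x,
    \forall k \near \oo, ~ bad j.+1%:R^-1 k x}.
  by move=> j; apply: bad_ae; rewrite invr_gt0.
apply: filterS => x xbad.
apply/cvgrPdist_le => e e0.
have e20 : 0 < e / 2 by rewrite divr_gt0.
have [j je] : exists j : nat, j.+1%:R^-1 <= e / 2.
  exists (Num.truncn (e / 2)^-1); rewrite -[leRHS]invrK lef_pV2 ?posrE ?invr_gt0//.
  by rewrite ltW// truncnS_gt.
have Nab : \forall k \near \oo, (b - a) / (e / 2) <= k%:R by exact: nbhs_infty_ger.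
near=> k.
have hk : h k <= 1 by near: k.
have : ~ bad j.+1%:R^-1 k x by near: k; exact: xbad.
rewrite /bad hk /= => /negP; rewrite -ltNge => Sm.
rewrite /R2 pair_count_sqr -/(N k) -/(u k) -/(S k x) powE.
have NN : (N k)%:R != 0 :> R by rewrite gt_eqF.
have uN : u k != 0 by rewrite gt_eqF.
have mE : m k = (b - a) * ((N k)%:R ^+ 2 - (N k)%:R) / u k.
  have Nk : (N k <= N k ^ 2)%N by rewrite -[leqLHS]expn1 leq_pexp2l// expn_gt0.
  by rewrite /m (natrB _ Nk) natrX hE mulrCA mulrA.
(* The first term comes from the absent diagonal, as [m k] counts N^2 - N pairs; the second is the
   deviation controlled by [bad]. Each is at most e / 2. *)
have -> : b - a - ((N k)%:R ^+ 2 / u k)^-1 * S k x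
   = (b - a) / (N k)%:R - (S k x - m k) / ((N k)%:R ^+ 2 / u k).
  by rewrite mE; field; rewrite uN NN.
apply: le_trans (ler_normB _ _) _.
rewrite (splitr e) lerD//.
  rewrite ger0_norm; last by rewrite divr_ge0// ltW.
  rewrite ler_pdivrMr// -ler_pdivrMl// mulrC.
  have : (b - a) / (e / 2) <= k%:R by near: k.
  move=> /le_trans; apply; rewrite NE.
  by apply: (@le_trans _ _ (n k)); [rewrite ler_nat | rewrite ler_eXnr].
have t0 : 0 < (N k)%:R ^+ 2 / u k by rewrite divr_gt0// exprn_gt0.
rewrite normrM normfV (gtr0_norm t0) ler_pdivrMr//.
apply: (le_trans (ltW Sm)); rewrite ler_pM2r//.
Unshelve. all: by end_near.
Qed.

(** * From eighth powers to all integers *)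

Lemma pair_count_le (R : realType) (sigma a b a' b' : R) (theta : nat -> R)
    (N N' : nat) : (N <= N')%N ->
  a' / N'%:R `^ sigma <= a / N%:R `^ sigma ->
  b / N%:R `^ sigma <= b' / N'%:R `^ sigma ->
  (pair_count sigma a b theta N <= pair_count sigma a' b' theta N')%N.
Proof.
move=> NN' aa bb; rewrite /pair_count.
pose f (p : 'I_N * 'I_N) := (widen_ord NN' p.1, widen_ord NN' p.2).
have fI : injective f.
  by move=> [i j] [i' j'] [ii' jj']; congr (_, _); apply: val_inj.
rewrite -(card_imset _ fI); apply: subset_leq_card.
apply/fintype.subsetP => _ /imsetP[[i j] + ->]; rewrite !inE /=.
move=> /andP[ij /in_itv_add_int[m mab]].
rewrite -val_eqE /= val_eqE ij /=; apply/in_itv_add_int; exists m.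
by case/andP: mab => ? ?; apply/andP; split; [apply: le_trans aa _|apply: le_trans bb].
Qed.

Lemma R2_ge0 (R : realType) (sigma a b : R) (theta : nat -> R) (N : nat) :
  0 <= R2 sigma a b theta N.
Proof. by rewrite /R2 mulr_ge0// invr_ge0 powR_ge0. Qed.

(** This serves the upper bound for [sigma = 0] and [b - a = 1], where no longer interval is
    admissible. *)
Lemma R2_le1 (R : realType) (a b : R) (theta : nat -> R) (N : nat) :
  R2 0 a b theta N <= 1.
Proof.
rewrite /R2 subr0; have [->|N0] := posnP N.
  by rewrite /pair_count eq_card0 ?mulr0// => -[[]].
rewrite mulrC ler_pdivrMr ?powR_gt0 ?ltr0n// mul1r.
rewrite powR_mulrn// -natrX ler_nat /pair_count.
by apply: leq_trans (max_card _) _; rewrite card_prod card_ord mulnn.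
Qed.

(** Put rho = N' / N. Both rho^sigma and rho^(2 - sigma) lie in [1, 1 + eta]: the first rescales the
    window, and the margins eta |a| and eta |b| absorb this for either sign of the endpoints; the
    second changes the normalisation. *)
Lemma R2_le_scale (R : realType) (sigma a b a' b' eta : R) (theta : nat -> R)
    (N N' : nat) : 0 <= sigma <= 2 -> (0 < N <= N')%N ->
  (N'%:R / N%:R) ^+ 2 <= 1 + eta ->
  a' + eta * `|a| <= a -> b + eta * `|b| <= b' ->
  R2 sigma a b theta N <= (1 + eta) * R2 sigma a' b' theta N'.
Proof.
move=> /andP[s0 s2] /andP[N0 NN'] rho2 aa bb.
have NR : 0 < N%:R :> R by rewrite ltr0n.
have N'R : 0 < N'%:R :> R by rewrite ltr0n (leq_trans N0).
set rho : R := N'%:R / N%:R in rho2.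
have rho1 : 1 <= rho by rewrite ler_pdivlMr// mul1r ler_nat.
have rho0 : 0 <= rho by rewrite (le_trans ler01).
have powle s : s <= 2 -> rho `^ s <= 1 + eta.
  move=> s2'; apply: le_trans rho2; rewrite -powR_mulrn//.
  by rewrite ler_powR.
have rs1 : 1 <= rho `^ sigma by rewrite -(powRr0 rho) ler_powR.
have rs2 := powle _ s2.
have N'E : N'%:R = rho * N%:R :> R by rewrite divfK// gt_eqF.
have psE s : N'%:R `^ s = rho `^ s * N%:R `^ s by rewrite N'E powRM.
have pN0 (s : R) : 0 < N%:R `^ s by apply: powR_gt0.
have pr0 s : 0 < rho `^ s by rewrite powR_gt0// (lt_le_trans ltr01).
have cnt : (pair_count sigma a b theta N <= pair_count sigma a' b' theta N')%N.
  apply: pair_count_le => //; rewrite psE.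
    rewrite invfM mulrA ler_pM2r ?invr_gt0// ler_pdivrMr//.
    apply: (@le_trans _ _ (a - eta * `|a|)); first lra.
    have : - `|a| <= a by rewrite lerNl ler_normr lexx orbT.
    have := normr_ge0 a; nra.
  rewrite invfM mulrA ler_pM2r ?invr_gt0// ler_pdivlMr//.
  apply: (@le_trans _ _ (b + eta * `|b|)); last lra.
  have := ler_norm b; have := normr_ge0 b; nra.
rewrite /R2 psE; set c : R := (pair_count _ _ _ _ N)%:R; set c' : R := (pair_count _ _ _ _ N')%:R.
have cc : c <= c' by rewrite ler_nat.
have -> : (1 + eta) * ((rho `^ (2 - sigma) * N%:R `^ (2 - sigma))^-1 * c')
    = (1 + eta) / rho `^ (2 - sigma) * ((N%:R `^ (2 - sigma))^-1 * c').
  by rewrite invfM; ring.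
apply: (@le_trans _ _ ((N%:R `^ (2 - sigma))^-1 * c')).
  by rewrite ler_wpM2l// invr_ge0 ltW.
rewrite ler_peMl ?mulr_ge0 ?invr_ge0 ?powR_ge0// ler_pdivlMr// mul1r.
by rewrite powle// gerBl.
Qed.

(** For large N, take the largest k with (k + 1)^8 <= N. *)
Lemma near_blocks (Q : nat -> Prop) :
  (\forall k \near \oo, forall N, (k.+1 ^ 8 <= N <= k.+2 ^ 8)%N -> Q N) ->
  \forall N \near \oo, Q N.
Proof.
move=> [K _ KQ]; exists (K.+1 ^ 8)%N => //= N KN.
have ex : exists k, (k.+1 ^ 8 <= N)%N by exists K.
have bnd k : (k.+1 ^ 8 <= N -> k <= N)%N.
  by apply: leq_trans; rewrite -[leqLHS]expn1; apply: leq_trans (leqnSn _) _;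
     rewrite -[leqLHS]expn1 leq_pexp2l.
have [k kN kmax] := ex_maxnP ex bnd.
apply: (KQ k); first exact: kmax.
rewrite kN /= leqNgt; apply/negP => Nk.
by have := kmax k.+1 (ltnW Nk); rewrite ltnn.
Qed.

(** The squared ratio is (1 + 1 / (k + 1))^16. The factor [C] stands for the fixed sizes of
    endpoints and counts that multiply eta. *)
Lemma block_ratio_near1 (R : realType) (C e : R) : 0 <= C -> 0 < e ->
  \forall k \near \oo, (((k.+2 ^ 8)%:R / (k.+1 ^ 8)%:R) ^+ 2 - 1) * C <= e.
Proof.
move=> C0 e0.
have h0 : (1 + k.+1%:R^-1 : R) @[k --> \oo] --> (1 + 0 : R).
  by apply: cvgD; [exact: cvg_cst|exact: cvg_harmonic].
have h : ((1 + k.+1%:R^-1) ^+ 16 : R) @[k --> \oo] --> ((1 + 0) ^+ 16 : R).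
  exact: (cvg_comp _ _ h0 (@exprn_continuous R 16 (1 + 0))).
have {}h : (((1 + k.+1%:R^-1) ^+ 16 - 1) * C : R) @[k --> \oo]
    --> (((1 + 0) ^+ 16 - 1) * C : R).
  by apply: cvgMl; apply: cvgB => //; exact: cvg_cst.
rewrite addr0 expr1n subrr mul0r in h.
have hle : \forall k \near \oo, ((1 + k.+1%:R^-1) ^+ 16 - 1) * C <= e.
  exact: (cvgr_le _ h).
near=> k.
suff -> : (((k.+2 ^ 8)%:R / (k.+1 ^ 8)%:R) ^+ 2 : R) = (1 + k.+1%:R^-1) ^+ 16.
  by near: k.
by rewrite !natrX -(natr1 k.+1) -exprVn -exprMn -exprM mulrDl divff ?mul1r.
Unshelve. all: by end_near.
Qed.

(** For N between (k + 1)^8 and (k + 2)^8, compare from above with (k + 2)^8 and a slightly larger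
    rational interval, from below with (k + 1)^8 and a slightly smaller one. *)
Lemma pair_correlation_of_pow8 (R : realType) (sigma : R) (theta : nat -> R) :
  0 <= sigma <= 2 ->
  (forall p q : rat, ratr p < ratr q :> R ->
     (sigma = 0 -> ratr q - ratr p <= 1 :> R) ->
     R2 sigma (ratr p) (ratr q) theta (k.+1 ^ 8) @[k --> \oo]
       --> (ratr q - ratr p : R)) ->
  pair_correlation sigma theta.
Proof.
move=> s02 cvg_rat a b ab sab.
have ratP (x y : R) : x < y -> exists q : rat, x < ratr q < y.
  by move=> /rat_in_itvoo[q]; rewrite in_itv/=; exists q.
pose eta k : R := ((k.+2 ^ 8)%:R / (k.+1 ^ 8)%:R) ^+ 2 - 1.
have etaE k : ((k.+2 ^ 8)%:R / (k.+1 ^ 8)%:R) ^+ 2 = 1 + eta k.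
  by rewrite /eta addrC subrK.
have eta0 k : 0 <= eta k.
  rewrite subr_ge0 exprn_ege1// ler_pdivlMr ?ltr0n ?expn_gt0// mul1r ler_nat.
  by rewrite leq_exp2r.
have ratio_le (i j k : nat) : (k.+1 ^ 8 <= i)%N -> (j <= k.+2 ^ 8)%N ->
    (j%:R / i%:R) ^+ 2 <= 1 + eta k.
  move=> ki jk; rewrite -etaE lerXn2r ?nnegrE ?divr_ge0//.
  have i0 : (0 < i)%N by rewrite (leq_trans _ ki)// expn_gt0.
  apply: ler_pM; rewrite ?invr_ge0// ?ler_nat//.
  by rewrite lef_pV2 ?posrE ?ltr0n ?expn_gt0// ler_nat.
have upper (e : R) : 0 < e -> \forall N \near \oo, R2 sigma a b theta N <= b - a + e.
  move=> e0; have [[s0 ba1]|nontriv] := pselect (sigma = 0 /\ b - a = 1).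
    by apply: nearW => N; rewrite ba1 s0 (le_trans (R2_le1 _ _ _ _))// lerDl ltW.
  (* Enlarging by [d] on both sides adds at most e / 3 to the length and, for [sigma = 0], keeps it
     at most 1. *)
  have [d d0 [de dle]] : exists2 d : R, 0 < d &
      (d <= e / 6 /\ (sigma = 0 -> b - a + 2 * d <= 1)).
    have e6 : 0 < e / 6 by rewrite divr_gt0.
    have [s0|s0] := pselect (sigma = 0); last by exists (e / 6) => //; split => // /s0.
    have ba1 : b - a < 1.
      by rewrite lt_neqAle sab// andbT; apply/eqP => ba1; exact: nontriv.
    exists (Num.min (e / 6) ((1 - (b - a)) / 2)).
      by rewrite lt_min e6/= divr_gt0// subr_gt0.
    split; first by rewrite ge_min lexx.
    have : Num.min (e / 6) ((1 - (b - a)) / 2) <= (1 - (b - a)) / 2.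
      by rewrite ge_min lexx orbT.
    by move=> ? _; lra.
  have [p /andP[p1 p2]] : exists p : rat, a - d < ratr p < a by apply: ratP; lra.
  have [q /andP[q1 q2]] : exists q : rat, b < ratr q < b + d by apply: ratP; lra.
  have pq : ratr p < ratr q :> R by lra.
  have spq : sigma = 0 -> ratr q - ratr p <= 1 :> R by move=> /dle; lra.
  have cv := cvg_rat p q pq spq.
  have near_lim : \forall k \near \oo,
      R2 sigma (ratr p) (ratr q) theta (k.+2 ^ 8) <= b - a + e / 2.
    have lt : ratr q - ratr p < b - a + e / 2 by lra.
    have [K _ KP] := cvgr_le _ cv _ lt; exists K => // k /= Kk.
    by apply: (KP k.+1); rewrite /= (leq_trans Kk).
  apply: near_blocks; near=> k => N /andP[kN Nk].
  have N0 : (0 < N)%N by rewrite (leq_trans _ kN)// expn_gt0.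
  apply: le_trans (R2_le_scale (eta := eta k) (a' := ratr p) (b' := ratr q) theta
    s02 _ (ratio_le _ _ _ kN (leqnn _)) _ _) _.
  - by rewrite N0.
  - have : eta k * `|a| <= a - ratr p.
      by near: k; apply: block_ratio_near1 => //; lra.
    lra.
  - have : eta k * `|b| <= ratr q - b.
      by near: k; apply: block_ratio_near1 => //; lra.
    lra.
  have : R2 sigma (ratr p) (ratr q) theta (k.+2 ^ 8) <= b - a + e / 2 by near: k.
  have : eta k * (b - a + e / 2) <= e / 2.
    by near: k; apply: block_ratio_near1; lra.
  have := eta0 k; set x := R2 _ _ _ _ _; set h := eta k => h0 hb xb.
  have : h * x <= h * (b - a + e / 2) by rewrite ler_wpM2l.
  lra.
have lower (e : R) : 0 < e -> \forall N \near \oo, b - a - e <= R2 sigma a b theta N.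
  move=> e0; have [bae|bae] := leP (b - a) e.
    by apply: nearW => N; apply: le_trans (R2_ge0 _ _ _ _ _); rewrite subr_le0.
  have d0 : 0 < e / 6 by rewrite divr_gt0.
  have [p /andP[p1 p2]] : exists p : rat, a < ratr p < a + e / 6 by apply: ratP; lra.
  have [q /andP[q1 q2]] : exists q : rat, b - e / 6 < ratr q < b by apply: ratP; lra.
  have pq : ratr p < ratr q :> R by lra.
  have spq : sigma = 0 -> ratr q - ratr p <= 1 :> R by move=> /sab; lra.
  have cv := cvg_rat p q pq spq.
  have near_lim : \forall k \near \oo,
      b - a - e / 2 <= R2 sigma (ratr p) (ratr q) theta (k.+1 ^ 8).
    have lt : b - a - e / 2 < ratr q - ratr p by lra.
    exact: (cvgr_ge _ cv _ lt).
  (* An a priori bound on R2 at N makes the loss from the factor 1 + eta at most e / 2. *)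
  have up : \forall k \near \oo, forall N, (k.+1 ^ 8 <= N)%N ->
      R2 sigma a b theta N <= b - a + 1.
    have [K _ KP] := upper 1 ltr01; exists K => // k /= Kk N kN; apply: KP => /=.
    rewrite (leq_trans Kk)// (leq_trans _ kN)// (leq_trans (leqnSn k))//.
    by rewrite -[leqLHS]expn1 leq_pexp2l.
  apply: near_blocks; near=> k => N /andP[kN Nk].
  have k0 : (0 < k.+1 ^ 8)%N by rewrite expn_gt0.
  have := R2_le_scale (eta := eta k) (a := ratr p) (b := ratr q) (a' := a) (b' := b)
    theta s02 _ (ratio_le _ _ _ (leqnn _) Nk) _ _.
  rewrite k0 kN => /(_ isT) scale.
  have {}scale : R2 sigma (ratr p) (ratr q) theta (k.+1 ^ 8)
      <= (1 + eta k) * R2 sigma a b theta N.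
    apply: scale.
      have : eta k * `|ratr p| <= ratr p - a.
        by near: k; apply: block_ratio_near1 => //; lra.
      lra.
    have : eta k * `|ratr q| <= b - ratr q.
      by near: k; apply: block_ratio_near1 => //; lra.
    lra.
  have : b - a - e / 2 <= R2 sigma (ratr p) (ratr q) theta (k.+1 ^ 8) by near: k.
  have : eta k * (b - a + 1) <= e / 2.
    by near: k; apply: block_ratio_near1; lra.
  have upk : forall N, (k.+1 ^ 8 <= N)%N -> R2 sigma a b theta N <= b - a + 1.
    by near: k.
  have := upk N kN; have := eta0 k.
  move: scale; set x := R2 _ _ _ _ _; set y := R2 _ _ _ _ N; set h := eta k.
  move=> xy h0 yb hb xb.
  have : h * y <= h * (b - a + 1) by rewrite ler_wpM2l.
  lra.
apply/cvgrPdist_le => e e0; near=> N.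
have lo : b - a - e <= R2 sigma a b theta N by near: N; exact: lower.
have up : R2 sigma a b theta N <= b - a + e by near: N; exact: upper.
by rewrite ler_norml; lra.
Unshelve. all: by end_near.
Qed.

(** * One set of full measure for all intervals *)

Theorem theorem2 (R : realType) (sigma : R) (sigma_ge0 : 0 <= sigma)
    (sigma_lt : sigma < 4^-1 * (9 - Num.sqrt 17)) :
  exists P : set R,
    (@lebesgue_measure R).-negligible (~` P) /\
    forall alpha : R, P alpha ->
      pair_correlation sigma (fun n : nat => alpha * n%:R ^+ 2).
Proof.
have sigma_le : sigma <= 5 / 4.
  have : 4 <= Num.sqrt (17 : R).
    by rewrite -[leLHS]ger0_norm// -sqrtr_sqr ler_sqrt; lra.
  by move: sigma_lt; lra.
(* Admissibility of the interval is a premise inside [good], so all pairs of rationals can be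
   enumerated; the default (0, 0) for codes of no pair satisfies [good] vacuously. *)
pose good (pq : rat * rat) (x : R) := ratr pq.1 < ratr pq.2 :> R ->
  (sigma = 0 -> ratr pq.2 - ratr pq.1 <= 1 :> R) ->
  R2 sigma (ratr pq.1) (ratr pq.2) (fun n => x * n%:R ^+ 2) (k.+1 ^ 8)
    @[k --> \oo] --> (ratr pq.2 - ratr pq.1 : R).
exists [set x | forall i : nat, good (odflt (0, 0) (unpickle i)) x]; split.
  apply: (@ae_foralln _ _ _ (@lebesgue_measure R)
    (fun i => good (odflt (0, 0) (unpickle i)))) => i.
  move: (odflt _ _) => pq.
  have [lt|nlt] := pselect (ratr pq.1 < ratr pq.2 :> R); last first.
    by apply: aeW => x /nlt.
  have [le1|nle1] := pselect (sigma = 0 -> ratr pq.2 - ratr pq.1 <= 1 :> R); last first.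
    by apply: aeW => x _ /nle1.
  have cvg_ae := ae_R2_pow8 sigma_ge0 sigma_le (ltW lt) le1.
  apply: (@filterS _ _ (ae_filter_ringOfSetsType (@lebesgue_measure R)) _ _ _ cvg_ae) => x xP _ _.
  exact: xP.
move=> x /= xP; apply: pair_correlation_of_pow8; first lra.
move=> p q pq spq; have := xP (pickle (p, q)).
by rewrite pickleK/= /good => /(_ pq spq).
Qed.
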